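(* Let $S$ be a (nonempty) semigroup with finitely many $\mathscr L$-classes, let $L_1,\dots, L_n$ be representative $\mathscr L$-classes for the $\mathscr D$-classes of $S$ (exactly one $\mathscr L$-class chosen from each $\mathscr D$-class), and let $m_r$ be the number of $\mathscr L$-classes contained in the $\mathscr D$-class containing $L_r$. Then \[ \mathrm{Ht}(\mathrm{LCong}(S)) = \sum_{r=1}^n m_r\, \bigl(\mathrm{Ht}(\mathrm{Cong}({}^S\overline{L}_r)) - 1\bigr). \]
   Context: The height $\mathrm{Ht}(P)$ of a poset $P$ is the supremum of the cardinalities of chains in $P$ (for infinite heights, sums and products are those of cardinals, and subtracting a finite number from an infinite cardinal leaves it unchanged). For a semigroup $S$, $S^1$ is $S$ if $S$ is a monoid and otherwise $S$ with an identity adjoined. Green's relations: $x\mathrel{\mathscr L}y\Leftrightarrow S^1x=S^1y$, $x\mathrel{\mathscr R}y\Leftrightarrow xS^1=yS^1$, and $\mathscr D=\mathscr L\vee\mathscr R$ (the join in the lattice of equivalence relations on $S$). A left congruence of $S$ is an equivalence relation $\sigma$ on $S$ such that $(x,y)\in\sigma$ implies $(ax,ay)\in\sigma$ for all $a\in S$; $\mathrm{LCong}(S)$ is the lattice of left congruences. A left $S$-act is a set $A$ with maps $a\mapsto s\cdot a$ ($s\in S$) satisfying $s\cdot(s'\cdot a)=(ss')\cdot a$; a congruence of $A$ is an equivalence relation $\sigma$ on $A$ such that $(a,b)\in\sigma$ implies $(s\cdot a,s\cdot b)\in\sigma$ for all $s\in S$, and $\mathrm{Cong}(A)$ is the lattice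 of congruences of $A$. For an $\mathscr L$-class $L$ of $S$, ${}^S\overline L$ is the left $S$-act with underlying set $\overline L=L\cup\{0\}$ (where $0\notin S$ is a new symbol) and action $s\cdot x=sx$ if $x\in L$ and $sx\in L$, and $s\cdot x=0$ otherwise. *)

(* Defs.v *)
From HB Require Import structures.
From mathcomp Require Import all_boot all_order.
From mathcomp Require Import finmap.
From mathcomp Require Import mathcomp_extra boolp classical_sets functions cardinality.
From Stdlib Require Import RelationClasses.

Set Implicit Arguments.
Unset Strict Implicit.
Unset Printing Implicit Defensive.

Local Open Scope classical_set_scope.
Local Open Scope group_scope.
Local Open Scope card_scope.

(* A cardinal is represented by any type or set having that cardinality;
   equality of cardinals is equipotence [#=] and their order is [#<=]. *)

Lemma card_le_inj_in (T U : Type) (A : set T) (B : set U) (f : T -> U) :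
  (forall t, A t -> B (f t)) ->
  (forall s t, A s -> A t -> f s = f t -> s = t) -> A #<= B.
Proof.
move=> fAB finj; have /card_eqPle[_ AfA] : f @` A #= A.
  by apply: inj_card_eq => s t /set_mem As /set_mem At; exact: finj.
by apply: card_le_trans AfA (subset_card_le _) => _ [t At <-]; exact: fAB.
Qed.

Lemma card_le_minimum (T : Type) (F : set (set T)) : F !=set0 ->
  exists2 K, F K & forall K', F K' -> K #<= K'.
Proof.
case=> K0 FK0.
pose P (M : set (set T -> T)) :=
  (forall f, M f -> forall K, F K -> K (f K)) /\
  (forall f g, M f -> M g -> forall K, F K -> f K = g K -> f = g).
have [G GP totG|M [[Msel Minj] Mmax]] := @Zorn_bigcup _ P.
  split=> [f [M GM Mf]|f g [M GM Mf] [N GN Ng]].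
    exact: (GP _ GM).1.
  have [MN|NM] := totG _ _ GM GN.
    by apply: (GP _ GN).2 => //; exact: MN.
  by apply: (GP _ GM).2 => //; exact: NM.
have [K FK Ksurj] : exists2 K, F K & forall t, K t -> exists2 f, M f & f K = t.
  apply: contrapT => noK.
  have ex K : F K -> exists t, K t /\ forall f, M f -> f K <> t.
    move=> FK; apply: contrapT => noT; apply: noK; exists K => // t Kt.
    apply: contrapT => nof; apply: noT; exists t; split=> // f Mf fKt.
    by apply: nof; exists f.
  have [t0 _] := ex _ FK0.
  have /boolp.choice[h hP] : forall K, exists t, F K ->
      K t /\ forall f, M f -> f K <> t.
    by move=> K; have [/ex[t ?]|nF] := pselect (F K); [exists t | exists t0].
  have Mh : ~ M h by move=> Mh; exact: (hP _ FK0).2 Mh erefl.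
  apply: (Mmax (M `|` [set h])).
    by split=> [f Mf|/(_ h (or_intror erefl))//]; left.
  split=> [f [/Msel//|->] K FK|f g [Mf|->] [Mg|->] K FK //].
  - exact: (hP _ FK).1.
  - exact: Minj.
  - by move=> e; case: ((hP _ FK).2 _ Mf e).
  - by move=> e; case: ((hP _ FK).2 _ Mg (esym e)).
exists K => // K' FK'.
have /boolp.choice[g gP] : forall t, exists f, K t -> M f /\ f K = t.
  move=> t; have [/Ksurj[f Mf fK]|nKt] := pselect (K t); first by exists f.
  by exists (fun=> t).
apply: (card_le_inj_in (f := fun t => g t K')) => [t Kt|s t Ks Kt e].
  exact: (Msel _ (gP _ Kt).1 _ FK').
have [[Mgs <-] [Mgt <-]] := (gP _ Ks, gP _ Kt).
by rewrite (Minj _ _ Mgs Mgt _ FK' e).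
Qed.

Lemma card_le_total (T U : Type) (A : set T) (B : set U) :
  A #<= B \/ B #<= A.
Proof.
have A_inl : @inl T U @` A #= A by apply: inj_card_eq => x y _ _ [].
have B_inr : @inr T U @` B #= B by apply: inj_card_eq => x y _ _ [].
have [|K] := @card_le_minimum (T + U) [set @inl T U @` A; @inr T U @` B].
  by exists (@inl T U @` A); left.
case=> -> minK; [left; have := minK _ (or_intror erefl)
               | right; have := minK _ (or_introl erefl)].
  by rewrite (card_le_eql A_inl) (card_le_eqr B_inr).
by rewrite (card_le_eql B_inr) (card_le_eqr A_inl).
Qed.

Definition is_card_sup (T : Type) (F : set (set T)) (U : Type) (K : set U) :=
  (forall C, F C -> C #<= K) /\
  (forall (V : Type) (K' : set V), (forall C, F C -> C #<= K') -> K #<= K').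

Lemma card_sup_exists (T : Type) (F : set (set T)) :
  exists K : set T, is_card_sup F K.
Proof.
pose ub := [set K : set T | forall C, F C -> C #<= K].
have [|K Kub Kmin] := @card_le_minimum T ub.
  by exists setT => C _; exact: card_leT.
exists K; split=> // V K' K'ub.
have [//|/card_leP[f]] := card_le_total K K'.
have K'f : [set val (f k) | k in [set: K']] #= K'.
  apply: card_eq_trans (card_setT K'); apply: inj_card_eq => a b _ _ /val_inj.
  by apply: inj; rewrite in_setT.
suff /Kmin : ub [set val (f k) | k in [set: K']] by rewrite (card_le_eqr K'f).
by move=> C /K'ub; rewrite (card_le_eqr K'f).
Qed.

(* The supremum of the cardinalities of the members of [F]; only its
   cardinality, characterized by [card_supP], is meaningful. *)
Definition card_sup (T : Type) (F : set (set T)) : set T :=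
  projT1 (cid (card_sup_exists F)).

Lemma card_supP (T : Type) (F : set (set T)) : is_card_sup F (card_sup F).
Proof. exact: projT2 (cid (card_sup_exists F)). Qed.

(* The cardinal [#|A| - k] for finite [k]. *)
Definition card_subn (T : choiceType) (A : set T) (k : nat) : Type :=
  if pselect (finite_set A) then 'I_(#|` fset_set A| - k) else set_type A.

(* A poset is a subset [P] of an ambient partially ordered type. *)
Definition chains (d : Order.disp_t) (T : porderType d) (P : set T) :
    set (set T) :=
  [set C | C `<=` P /\ total_on C (fun x y => x <= y)%O].

Definition Ht (d : Order.disp_t) (T : porderType d) (P : set T) : set T :=
  card_sup (chains P).

Section Green.
Variable S : semigroupType.
Implicit Types (x y : S) (D : set S).

Definition has_identity := exists e : S, forall x, e * x = x /\ x * e = x.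

(* [S^1] as a subset of [option S], [None] being the adjoined identity. *)
Definition monoid1 : set (option S) :=
  [set s | s = None -> ~ has_identity].

Definition mul1l (s : option S) x := if s is Some a then a * x else x.
Definition mul1r x (s : option S) := if s is Some a then x * a else x.

Definition greenL x y :=
  [set mul1l s x | s in monoid1] = [set mul1l s y | s in monoid1].
Definition greenR x y :=
  [set mul1r x s | s in monoid1] = [set mul1r y s | s in monoid1].

(* The least equivalence relation containing [greenL] and [greenR]. *)
Definition greenD x y := forall E : S -> S -> Prop, Equivalence E ->
  (forall a b, greenL a b -> E a b) -> (forall a b, greenR a b -> E a b) ->
  E x y.

Definition Lclasses : set (set S) := [set [set y | greenL x y] | x in setT].
Definition Dclasses : set (set S) := [set [set y | greenD x y] | x in setT].
Definition Lclasses_in D : set (set S) := [set L | Lclasses L /\ L `<=` D].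

(* Binary relations are sets of pairs; [set (X * X)] is ordered by inclusion. *)
Definition equivalences (X : Type) : set (set (X * X)) :=
  [set s | Equivalence (fun u v : X => s (u, v))].

Definition LCong : set (set (S * S)) :=
  [set s | equivalences s /\
    forall x y, s (x, y) -> forall a : S, s (a * x, a * y)].

Record left_act := LeftAct {
  act_sort :> Type;
  act : S -> act_sort -> act_sort;
  actM : forall (s s' : S) (a : act_sort), act s (act s' a) = act (s * s') a
}.

Definition Cong (A : left_act) : set (set (A * A)) :=
  [set s | equivalences s /\
    forall a b, s (a, b) -> forall t : S, s (act t a, act t b)].

(* [L] with a new point [None] for the symbol 0; [insub z] is [Some z] when
   [z \in L] and [None] otherwise. *)
Definition Lbar_act (L : set S) (s : S) (a : option L) : option L :=
  obind (fun x : L => insub (s * val x)) a.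

Lemma Lclass_factor (L : set S) (s s' x : S) : Lclasses L ->
  L x -> L (s * s' * x) -> L (s' * x).
Proof.
case=> z _ <-; rewrite /greenL /= => -> {z} xss'x.
apply/seteqP; split=> _ [t Mt <-].
  have : [set mul1l u x | u in monoid1] (mul1l t x) by exists t.
  rewrite xss'x => -[u Mu <-]; rewrite -mulgA.
  case: u Mu => [b|] _ /=; first by exists (Some (b * s)); rewrite //= !mulgA.
  by exists (Some s).
have [u Mu <-] : exists2 u, monoid1 u & mul1l u x = mul1l t (s' * x).
  case: t Mt => [b|] _ /=; first by exists (Some (b * s')); rewrite //= !mulgA.
  by exists (Some s').
by exists u.
Qed.

Lemma Lbar_actM (L : set S) : Lclasses L ->
  forall s s' (a : option L), Lbar_act s (Lbar_act s' a) = Lbar_act (s * s') a.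
Proof.
move=> LL s s' [x|//] /=; case: insubP => [y Ly yE|nLy] /=.
  by rewrite yE mulgA.
case: insubP => // z /set_mem Lz _; case/negP: nLy; apply/mem_set.
exact: Lclass_factor LL (set_mem (valP x)) Lz.
Qed.

Definition Lbar (L : set S) (LL : Lclasses L) : left_act :=
  LeftAct (Lbar_actM LL).

End Green.

Arguments has_identity S : clear implicits.
Arguments monoid1 S _ : clear implicits.
Arguments Lclasses S _ : clear implicits.
Arguments Dclasses S _ : clear implicits.
Arguments LCong S _ : clear implicits.
Arguments Cong {S} A _.
Arguments Ht {d T} P _.
Arguments Lclasses_in {S} D _.

(* Main.v *)
Require Import Defs.
From mathcomp Require Import all_boot all_order.
From mathcomp Require Import finmap.
From mathcomp Require Import zify.
From mathcomp Require Import boolp classical_sets functions cardinality.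
From Stdlib Require Import RelationClasses.

Set Implicit Arguments.
Unset Strict Implicit.
Unset Printing Implicit Defensive.

Local Open Scope classical_set_scope.
Local Open Scope card_scope.

(** The height is additive along a filtration of an act.  View [S] as a left
act over itself.  If [B] is a subact of an act [A], a congruence of [A] has a
trace on [B] and an image on the Rees quotient [A / B], and two comparable
congruences with the same trace and the same image are equal ([agree_step] is
this argument).  Conversely, a chain of congruences of [B], extended by equality
outside [B], can be continued by a chain of congruences of [A / B], pulled back
to [A].

Order the finitely many L-classes linearly, compatibly with the order of
principal left ideals ([Lclass_ranking]).  The initial unions are left ideals,
and the successive Rees quotients are the acts [Lbar X], except that for the
lowest class [X] the zero of [Lbar X] is not the image of anything.  There [X]
is a minimal left ideal, and the total relation is the only congruence of
[Lbar X] in which the zero is not isolated, so that the height of [X] itself is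
the height of [Lbar X] minus one.  Each later class also contributes the height
of its act minus one, because the least congruence of a quotient is the greatest
one of the previous stage.  Altogether [Ht (LCong S)] is the sum, over all
L-classes [X], of [Ht (Cong (Lbar X)) - 1] ([Ht_LCong_Lclasses]).

Infinite heights need no separate treatment in the upper bound: a chain of
left congruences is injected directly into the disjoint union of its images in
the quotients, with the total congruence removed ([Ht_LCong_le]).  Each member
[sigma] of the chain is recorded at the lowest layer at which it becomes the
greatest member with its trace.  For the lower bound, if all heights are finite
they are attained by chains, and these are put on top of each other
([sum_le_Ht_LCong]); otherwise [Ht (LCong S)] is an infinite cardinal above
every summand, and it absorbs finite sums ([infinite_mulnat]).

Finally, by Green's lemma, right translations make the acts of the L-classes in
one D-class isomorphic ([Ht_Lbar_eq_of_greenD]), so the sum over L-classes can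
be collected into one term for each D-class ([card_eq_sigT_fibres]). *)

(** * Cardinal arithmetic *)

(** Injections are given as relations: this spares default values when the
target may be empty, and transports when it is a dependent sum. *)
Lemma card_le_rel (T U : Type) (A : set T) (B : set U) (R : T -> U -> Prop) :
    (forall t, A t -> exists2 u, B u & R t u) ->
    (forall s t u, A s -> A t -> R s u -> R t u -> s = t) ->
  A #<= B.
Proof.
move=> Rtot Rinj; have [->|/set0P[t0 /Rtot[u0 _ _]]] := eqVneq A set0.
  exact: card_ge0.
have /boolp.choice[f fP] t : exists u, A t -> B u /\ R t u.
  have [/Rtot[u Bu Rtu]|nAt] := pselect (A t); first by exists u.
  by exists u0.
apply: (card_le_inj_in (f := f)) => [t /fP[]//|s t As At fst].
apply: (Rinj _ _ (f s)) => //; first exact: (fP _ As).2.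
by rewrite fst; exact: (fP _ At).2.
Qed.

Lemma card_le_relE (T U : Type) (A : set T) (B : set U) : A #<= B ->
  exists R : T -> U -> Prop, (forall t, A t -> exists2 u, B u & R t u) /\
    (forall s t u, A s -> A t -> R s u -> R t u -> s = t).
Proof.
move=> /card_leP[f].
exists (fun t u => exists2 x : A, val x = t & val (f x) = u).
split=> [t At|s t u _ _ [x <- fxu] [y <-]].
  have sA := mem_set At.
  by exists (val (f (SigSub sA))); [exact: set_valP | exists (SigSub sA)].
by rewrite -fxu => /val_inj /inj -> //; rewrite in_setT.
Qed.

(** By Zorn's lemma there is a maximal family of pairwise disjoint injective
sequences in [A]; what it leaves over is finite.  Hence [A] is, up to a finite
set, a union of copies of [nat], and each copy can make room for [nat * nat] and
one of them also for the finite rest. *)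
Lemma infinite_mulnat (T : Type) (A : set T) : infinite_set A ->
  A `*` [set: nat] #<= A.
Proof.
move=> Ainf.
pose P (M : set (nat -> T)) :=
  (forall f, M f -> injective f /\ forall i, A (f i)) /\
  (forall f g i j, M f -> M g -> f i = g j -> f = g).
have [G GP totG|M [[Minj Mdisj] Mmax]] := @Zorn_bigcup _ P.
  split=> [f [M GM Mf]|f g i j [M GM Mf] [N GN Ng]]; first exact: (GP _ GM).1.
  have [MN|NM] := totG _ _ GM GN.
    by apply: (GP _ GN).2 => //; exact: MN.
  by apply: (GP _ GM).2 => //; exact: NM.
pose B := A `&` [set t | ~ exists f i, M f /\ f i = t].
have Bfin : finite_set B.
  apply: contrapT => /infiniteP/card_le_relE[R [Rtot Rinj]].
  have /boolp.choice[f fP] i : exists t, B t /\ R i t.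
    by have [t] := Rtot i I; exists t.
  have finj : injective f.
    move=> i j fij; apply: (Rinj i j (f i)) => //; first exact: (fP i).2.
    by rewrite fij; exact: (fP j).2.
  have fM : ~ M f by move=> Mf; apply: (fP 0).1.2; exists f, 0.
  apply: (Mmax (M `|` [set f])).
    by split=> [g|/(_ f (or_intror erefl))//]; left.
  split=> [g [/Minj//|->]|g h i j].
    by split=> // i; exact: (fP i).1.1.
  case=> [Mg|->] [Mh|->] // e; first exact: Mdisj Mg Mh e.
    by case: (fP j).1.2; exists g, i.
  by case: (fP i).1.2; exists h, j.
(* The sequence [f0] absorbs the finite remainder [B]. *)
have [f0 Mf0] : M !=set0.
  apply/set0P/eqP => M0; apply: Ainf; suff -> : A = B by [].
  apply/seteqP; split=> [t At|t []//]; split=> // -[f [i []]].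
  by rewrite M0.
have /finite_set_countable/card_le_relE[e [etot einj]] := Bfin.
pose code (b : bool) (i n : nat) := choice.pickle ((b, i), n).
apply: (@card_le_rel _ _ _ _ (fun p u =>
  (exists f i, [/\ M f, f i = p.1 & u = f (code true i p.2)]) \/
  (exists i, [/\ B p.1, e p.1 i & u = f0 (code false i p.2)]))).
  move=> [t n] [/= At _].
  have [[f [i [Mf fit]]]|nt] := pselect (exists f i, M f /\ f i = t).
    exists (f (code true i n)); first exact: (Minj _ Mf).2.
    by left; exists f, i.
  have Bt : B t by [].
  have [i _ eti] := etot _ Bt.
  exists (f0 (code false i n)); first exact: (Minj _ Mf0).2.
  by right; exists i.
have codeI b i m c j n : code b i m = code c j n -> [/\ b = c, i = j & m = n].
  by move=> /(pcan_inj choice.pickleK)[].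
move=> [s m] [t n] u _ _ /=.
move=> [[f [i [Mf <- ->]]]|[i [Bs ei ->]]].
  move=> [[g [j [Mg <- E]]]|[j [Bt ej E]]].
    have fg := Mdisj _ _ _ _ Mf Mg E; move: E; rewrite fg.
    by move=> /(Minj _ Mg).1/codeI[_ -> ->].
  have fg := Mdisj _ _ _ _ Mf Mf0 E; move: E; rewrite fg.
  by move=> /(Minj _ Mf0).1/codeI[].
move=> [[g [j [Mg <- E]]]|[j [Bt ej E]]].
  have fg := Mdisj _ _ _ _ Mf0 Mg E; move: E; rewrite fg.
  by move=> /(Minj _ Mg).1/codeI[].
move: E => /(Minj _ Mf0).1/codeI[_ ij ->].
by congr (_, _); apply: einj Bs Bt ei _; rewrite ij.
Qed.
Lemma card_eq_leL (T U : Type) (A : set T) (B : set U) : A #= B -> A #<= B.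
Proof. by rewrite card_eq_le => /andP[]. Qed.

Lemma card_eq_leR (T U : Type) (A : set T) (B : set U) : A #= B -> B #<= A.
Proof. by rewrite card_eq_le => /andP[]. Qed.

(** Each element of [A] is sent to one summand, chosen among its possible
tags, and needs to be determined by its image only among the elements with that
tag. *)
Lemma card_le_sigT (J T : Type) (V F : J -> Type) (A : set T)
    (tag : T -> J -> Prop) (g : forall i, T -> V i) (B : forall i, set (V i)) :
    (forall i, B i #<= [set: F i]) ->
    (forall t, A t -> exists i, tag t i) ->
    (forall t i, A t -> tag t i -> B i (g i t)) ->
    (forall s t i, A s -> A t -> tag s i -> tag t i -> g i s = g i t -> s = t) ->
  A #<= [set: {i & F i}].
Proof.
move=> BF tagP gB ginj; have R i := cid (card_le_relE (BF i)).
apply: (@card_le_rel _ _ _ _ (fun t (p : {i & F i}) =>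
  tag t (projT1 p) /\ sval (R (projT1 p)) (g (projT1 p) t) (projT2 p))).
  move=> t At; have [i ti] := tagP _ At.
  have [z _ Rz] := (svalP (R i)).1 _ (gB _ _ At ti).
  by exists (existT _ i z).
move=> s t [i z] As At [/= si Rs] [/= ti Rt]; apply: ginj (si) (ti) _ => //.
exact: (svalP (R i)).2 (gB _ _ As si) (gB _ _ At ti) Rs Rt.
Qed.

Lemma sigT_card_le (J T : Type) (V F : J -> Type) (A : set T)
    (B : forall i, set (V i)) (g : forall i, V i -> T) :
    (forall i, [set: F i] #<= B i) ->
    (forall i v, B i v -> A (g i v)) ->
    (forall i j v w, B i v -> B j w -> g i v = g j w -> i = j) ->
    (forall i v w, B i v -> B i w -> g i v = g i w -> v = w) ->
  [set: {i & F i}] #<= A.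
Proof.
move=> FB gA gtag ginj; have R i := cid (card_le_relE (FB i)).
apply: (@card_le_rel _ _ _ _ (fun (p : {i & F i}) t => exists v : V (projT1 p),
  [/\ B _ v, sval (R (projT1 p)) (projT2 p) v & t = g _ v])).
  move=> [i z] _; have [v Bv Rv] := (svalP (R i)).1 z I.
  by exists (g i v); [exact: gA | exists v].
move=> [i z] [j w] _ _ _ [/= v [Bv Rzv ->]] [/= v' [Bv' Rwv' E]].
have ij := gtag _ _ _ _ Bv Bv' E; subst j.
have vv := ginj _ _ _ Bv Bv' E; subst v'.
by rewrite ((svalP (R i)).2 _ _ _ I I Rzv Rwv').
Qed.

Lemma card_eq_sigT_fibres (J K : Type) (rho : J -> K) (F : J -> Type) (M G : K -> Type) :
    (forall r, [set j | rho j = r] #= [set: M r]) ->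
    (forall j r, rho j = r -> [set: F j] #= [set: G r]) ->
  [set: {j & F j}] #= [set: {r & (M r * G r)%type}].
Proof.
move=> rhoM FG; rewrite card_eq_le; apply/andP; split.
  have N r := cid (card_le_relE (card_eq_leL (rhoM r))).
  have Q j r : exists R : F j -> G r -> Prop, rho j = r ->
      (forall z, exists w, R z w) /\ (forall z z' w, R z w -> R z' w -> z = z').
    have [jr|] := pselect (rho j = r); last by exists (fun _ _ => False).
    have [R [Rtot Rinj]] := card_le_relE (card_eq_leL (FG j r jr)).
    exists R => _; split=> [z|z z' w]; last exact: Rinj.
    by have [w] := Rtot z I; exists w.
  apply: (@card_le_rel _ _ _ _ (fun (p : {j & F j}) (q : {r & (M r * G r)%type}) =>
    [/\ rho (projT1 p) = projT1 q, sval (N (projT1 q)) (projT1 p) (projT2 q).1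
      & sval (cid (Q (projT1 p) (projT1 q))) (projT2 p) (projT2 q).2])).
    move=> [j z] _; have [i _ Nji] := (svalP (N (rho j))).1 j erefl.
    have [w Qzw] := (svalP (cid (Q j (rho j))) erefl).1 z.
    by exists (existT _ (rho j) (i, w)).
  move=> [j z] [j' z'] [r [i w]] _ _ [/= jr Nji Qzw] [/= j'r Nj'i Qz'w].
  have jj' := (svalP (N r)).2 _ _ _ jr j'r Nji Nj'i; subst j'.
  by rewrite ((svalP (cid (Q j r)) jr).2 _ _ _ Qzw Qz'w).
have N r := cid (card_le_relE (card_eq_leR (rhoM r))).
have Q j r : exists R : G r -> F j -> Prop, rho j = r ->
    (forall w, exists z, R w z) /\ (forall w w' z, R w z -> R w' z -> w = w').
  have [jr|] := pselect (rho j = r); last by exists (fun _ _ => False).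
  have [R [Rtot Rinj]] := card_le_relE (card_eq_leR (FG j r jr)).
  exists R => _; split=> [w|w w' z]; last exact: Rinj.
  by have [z] := Rtot w I; exists z.
apply: (@card_le_rel _ _ _ _ (fun (q : {r & (M r * G r)%type}) (p : {j & F j}) =>
  [/\ rho (projT1 p) = projT1 q, sval (N (projT1 q)) (projT2 q).1 (projT1 p)
    & sval (cid (Q (projT1 p) (projT1 q))) (projT2 q).2 (projT2 p)])).
  move=> [r [i w]] _; have [j jr Nij] := (svalP (N r)).1 i I.
  have [z Qwz] := (svalP (cid (Q j r)) jr).1 w.
  by exists (existT _ j z).
move=> [r [i w]] [r' [i' w']] [j z] _ _ [/= jr Nij Qwz] [/= jr' Ni'j Qw'z].
subst r r'; rewrite ((svalP (N _)).2 _ _ _ I I Nij Ni'j).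
by rewrite ((svalP (cid (Q j (rho j))) erefl).2 _ _ _ Qwz Qw'z).
Qed.

Lemma card_setD1_II (T : choiceType) (A : set T) (p : T) n : A #= `I_n ->
  A `\ p #= `I_(n - (p \in A)).
Proof.
move=> An; have Afin : finite_set A by apply/finite_setP; exists n.
have /finite_setP[m Dm] : finite_set (A `\ p) by exact: finite_setD.
suff <- : m = n - (p \in A) by [].
rewrite -(card_fset_set Dm) -(card_fset_set An) fset_setD1//.
by rewrite [X in X - _](cardfsD1 p) in_fset_set// addKn.
Qed.

(** An infinite cardinal absorbs one more point: in [B * nat], the images of the
points of [A] other than [p] are paired with 0, which leaves room for [p]. *)
Lemma infinite_card_leD1 (T U : Type) (A : set T) (p : T) (B : set U) :
  infinite_set B -> A `\ p #<= B -> A #<= B.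
Proof.
move=> Binf /card_le_relE[R [Rtot Rinj]].
apply: card_le_trans (infinite_mulnat Binf).
have [b0 Bb0] := infinite_setN0 Binf.
apply: (@card_le_rel _ _ _ _ (fun t (q : U * nat) =>
  (t = p /\ q.2 = 1) \/ (t <> p /\ R t q.1 /\ q.2 = 0))) => [t At|].
  have [->|tp] := pselect (t = p); first by exists (b0, 1); [|left].
  by have [u Bu Rtu] := Rtot t (conj At tp); exists (u, 0); [|right].
move=> s t [u k] As At /= [[-> ->]|[sp [Rs ->]]] [[-> //]|[tp [Rt]]] //.
by move=> _; exact: Rinj Rs Rt.
Qed.

Section CardSubn.
Variables (T : choiceType) (A : set T) (k : nat).

Lemma card_subn_finite n : A #= `I_n -> [set: card_subn A k] #= `I_(n - k).
Proof.
move=> An; rewrite /card_subn; case: pselect => [Afin|nAfin]; last first.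
  by case: nAfin; apply/finite_setP; exists n.
by rewrite (card_fset_set An) card_eq_sym; exact: card_II.
Qed.

Lemma card_subn_infinite : infinite_set A -> [set: card_subn A k] #= A.
Proof.
move=> Ainf; rewrite /card_subn; case: pselect => // nAfin; exact: card_setT.
Qed.

End CardSubn.

Lemma card_subn_eq (T U : choiceType) (A : set T) (B : set U) k : A #= B ->
  [set: card_subn A k] #= [set: card_subn B k].
Proof.
move=> AB; have [/finite_setP[n An]|Ainf] := pselect (finite_set A).
  apply: card_eq_trans (card_subn_finite k An) _; rewrite card_eq_sym.
  by apply: card_subn_finite; rewrite -(card_eql AB).
apply: card_eq_trans (card_subn_infinite k Ainf) _.
apply: (card_eq_trans AB); rewrite card_eq_sym; apply: card_subn_infinite.
by rewrite -(eq_finite_set AB).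
Qed.

(** * Height and reduced height *)

Section Height.
Variables (d : Order.disp_t) (T : porderType d) (P : set T).

Lemma chain_le_Ht C : chains P C -> C #<= Ht P.
Proof. exact: (card_supP _).1. Qed.

Lemma Ht_le_of_chains (U : Type) (K : set U) :
  (forall C, chains P C -> C #<= K) -> Ht P #<= K.
Proof. exact: (card_supP _).2. Qed.

(** A supremum of natural numbers that is finite is a maximum. *)
Lemma finite_Ht_attained : finite_set (Ht P) -> exists2 C, chains P C & C #= Ht P.
Proof.
move=> /finite_setP[n Hn].
have [C chC nC] : exists2 C, chains P C & `I_n #<= C.
  apply: contrapT; case: n Hn => [|n] Hn noC.
    apply: noC; exists set0; first by split.
    by rewrite II0; exact: card_ge0.
  have : Ht P #<= `I_n.
    apply: Ht_le_of_chains => C chC; apply: contrapT => CIn; apply: noC.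
    exists C => //; have := chain_le_Ht chC; rewrite (card_le_eqr Hn) => Cn.
    have /finite_setP[m Cm] : finite_set C by apply/finite_set_leP; exists n.+1.
    rewrite (card_le_eqr Cm) card_le_II ltnNge.
    by apply/negP => mn; apply: CIn; rewrite (card_le_eql Cm) card_le_II.
  by rewrite (card_le_eql Hn) card_le_II ltnn.
exists C => //; rewrite (card_eqr Hn) card_eq_le nC andbT.
by rewrite -(card_le_eqr Hn); exact: chain_le_Ht.
Qed.

(** With the next lemma: [Ht P - 1] is the supremum of the sizes of the chains
of [P] with the point [p] removed, when [p] can be added to every chain.  Stating
it for infinite heights too is what lets the finite and the infinite case of the
upper bound be proved together. *)
Lemma chainD1_le_card_subn C p : chains P C -> C p ->
  C `\ p #<= [set: card_subn (Ht P) 1].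
Proof.
move=> /chain_le_Ht CH Cp; have [/finite_setP[n Hn]|Hinf] := pselect (finite_set (Ht P)).
  rewrite (card_le_eqr (card_subn_finite 1 Hn)).
  move: CH; rewrite (card_le_eqr Hn) => Cn.
  have /finite_setP[m Cm] : finite_set C by apply/finite_set_leP; exists n.
  rewrite (card_le_eql (card_setD1_II p Cm)) card_le_II mem_set// leq_sub2r//.
  by rewrite -card_le_II -(card_le_eql Cm).
rewrite (card_le_eqr (card_subn_infinite 1 Hinf)).
exact: card_le_trans (card_le_setD _ _) CH.
Qed.

Lemma card_subn_Ht_le (U : Type) (K : set U) (p : T) :
  (forall C, chains P C -> C `\ p #<= K) -> [set: card_subn (Ht P) 1] #<= K.
Proof.
move=> PK; have [Hfin|Hinf] := pselect (finite_set (Ht P)).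
  have [C chC CH] := finite_Ht_attained Hfin; have /finite_setP[n Hn] := Hfin.
  rewrite (card_le_eql (card_subn_finite 1 Hn)).
  have Cn := card_eq_trans CH Hn.
  apply: card_le_trans (PK _ chC); rewrite (card_le_eqr (card_setD1_II p Cn)).
  by rewrite card_le_II leq_sub2l// leq_b1.
rewrite (card_le_eql (card_subn_infinite 1 Hinf)).
(* A finite [K] of size [k] would bound all chains by [k + 1]. *)
have Kinf : infinite_set K.
  move=> /finite_setP[k Kk]; apply: Hinf; apply/finite_set_leP; exists k.+1.
  apply: Ht_le_of_chains => C /PK; rewrite (card_le_eqr Kk) => Ck.
  have Dfin : finite_set (C `\ p) by apply/finite_set_leP; exists k.
  have /finite_setP[m Cm] : finite_set C.
    apply: (@sub_finite_set _ _ (C `\ p `|` [set p])).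
      by move=> x Cx; have [->|xp] := pselect (x = p); [right|left].
    by rewrite finite_setU; split=> //; exact: finite_set1.
  move: Ck; rewrite (card_le_eql (card_setD1_II p Cm)) (card_le_eql Cm).
  rewrite !card_le_II; case: (p \in C); rewrite ?subn1 ?subn0; lia.
apply: Ht_le_of_chains => C /PK; exact: infinite_card_leD1.
Qed.

End Height.

Lemma Ht_le_mono (d d' : Order.disp_t) (T : porderType d) (U : porderType d')
    (P : set T) (Q : set U) (f : T -> U) :
    (forall x, P x -> Q (f x)) -> (forall x y, P x -> P y -> f x = f y -> x = y) ->
    (forall x y, (x <= y -> f x <= f y)%O) ->
  Ht P #<= Ht Q.
Proof.
move=> fPQ finj fmono; apply: Ht_le_of_chains => C [CP Ctot].
have Cf : C #<= f @` C.
  apply: (card_le_inj_in (f := f)) => [t Ct|s t Cs Ct]; first by exists t.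
  by apply: finj; exact: CP.
apply: card_le_trans Cf (chain_le_Ht _); split=> [_ [x /CP Px <-]|]; first exact: fPQ.
by move=> _ _ [x Cx <-] [y Cy <-]; have [/fmono|/fmono] := Ctot _ _ Cx Cy; auto.
Qed.
(** * Green's relations and the order of L-classes *)

Section Green.
Variable S : semigroupType.
Implicit Types (a s t x y z : S) (X Y : set S).
Local Open Scope group_scope.

(** [y \in S^1 x]; adjoining the identity amounts to allowing [y = x]. *)
Definition belowL y x := y = x \/ exists a, y = a * x.

(** [y \in x S^1]. *)
Definition belowR y x := y = x \/ exists a, y = x * a.

Lemma belowL_refl x : belowL x x. Proof. by left. Qed.

Lemma belowL_mul a x : belowL (a * x) x. Proof. by right; exists a. Qed.

Lemma belowL_trans y x z : belowL x y -> belowL y z -> belowL x z.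
Proof.
move=> [->//|[a ->]] [->|[b ->]]; first by right; exists a.
by right; exists (a * b); rewrite mulgA.
Qed.

Lemma belowLE x : [set mul1l s x | s in monoid1 S] = [set y | belowL y x].
Proof.
apply/seteqP; split=> [y [[a|] _ <-]|y [->|[a ->]]] /=; try by [left|right; exists a].
  have [[e eP]|S1] := pselect (has_identity S); last by exists None.
  by exists (Some e) => //=; rewrite (eP x).1.
by exists (Some a).
Qed.

Lemma belowRE x : [set mul1r x s | s in monoid1 S] = [set y | belowR y x].
Proof.
apply/seteqP; split=> [y [[a|] _ <-]|y [->|[a ->]]] /=; try by [left|right; exists a].
  have [[e eP]|S1] := pselect (has_identity S); last by exists None.
  by exists (Some e) => //=; rewrite (eP x).2.
by exists (Some a).
Qed.

Lemma greenLP x y : greenL x y <-> belowL x y /\ belowL y x.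
Proof.
rewrite /greenL !belowLE; split=> [/seteqP[xy yx]|[xy yx]].
  by split; [apply: xy | apply: yx]; exact: belowL_refl.
by apply/seteqP; split=> z zx; [exact: belowL_trans xy | exact: belowL_trans yx].
Qed.

Lemma greenR_below x y : greenR x y -> belowR x y /\ belowR y x.
Proof.
by rewrite /greenR !belowRE => /seteqP[xy yx]; split; [apply: xy | apply: yx]; left.
Qed.

Lemma greenL_refl x : greenL x x. Proof. by []. Qed.

Lemma greenL_mulr x y s : greenL x y -> greenL (x * s) (y * s).
Proof.
have bel u v : belowL u v -> belowL (u * s) (v * s).
  by move=> [->|[a ->]]; [left | right; exists a; rewrite mulgA].
by move=> /greenLP[/bel xy /bel yx]; apply/greenLP.
Qed.

Definition Lclass x : set S := [set y | greenL x y].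

Lemma Lclass_in x : Lclasses S (Lclass x). Proof. by exists x. Qed.

Lemma eq_Lclass x y : greenL x y -> Lclass x = Lclass y.
Proof. by rewrite /Lclass /greenL => ->. Qed.

Lemma LclassesP X x : Lclasses S X -> X x -> X = Lclass x.
Proof. by move=> [y _ <-] /eq_Lclass. Qed.

Section LinearExtension.
Hypothesis finL : finite_set (Lclasses S).

(** A linear extension of the order of L-classes: sort them by the number of
classes below them, which strictly increases along the order, and let [key x] be
the position of the class of [x]. *)
Lemma Lclass_ranking : exists (N : nat) (key : S -> nat),
  [/\ forall a x, key (a * x)%g <= key x,
      forall x y, key x = key y <-> greenL x y,
      forall x, key x < N &
      forall k, k < N -> exists x, key x = k]%N.
Proof.
have /finite_seqP[s0 Es0] := finL.
pose below Y X := exists y x, [/\ Y y, X x & belowL y x].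
have belowE x y : below (Lclass y) (Lclass x) <-> belowL y x.
  split=> [[y' [x' [/greenLP[yy' _] /greenLP[_ x'x] yx]]]|yx]; last by exists y, x.
  by apply: belowL_trans yy' (belowL_trans yx x'x).
pose s := undup s0.
have sP X : X \in s = `[< Lclasses S X >].
  by rewrite mem_undup; apply/idP/asboolP; rewrite Es0.
have sC x : Lclass x \in s by rewrite sP; apply/asboolP; exact: Lclass_in.
pose h X := count (fun Y => `[< below Y X >]) s.
have h_lt x y : belowL y x -> ~ belowL x y -> (h (Lclass y) < h (Lclass x))%N.
  move=> yx nxy; pose q Y := `[< below Y (Lclass y) >].
  have /leq_trans -> // : (h (Lclass y) < count (predU q (pred1 (Lclass x))) s)%N.
    rewrite -[ltnRHS]addn0 -[X in (_ < _ + X)%N](count_pred0 s).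
    rewrite -(_ : count (predI q (pred1 (Lclass x))) s = count pred0 s).
      rewrite count_predUI -[X in (X < _)%N]addn0 ltn_add2l -has_count.
      by apply/hasP; exists (Lclass x) => /=.
    apply: eq_count => Y /=; apply/negP => /andP[/asboolP bY /eqP EY].
    by apply: nxy; apply/belowE; rewrite -EY.
  apply: sub_count => Y /orP[/asboolP[z [y' [Yz /greenLP[_ y'y] zy']]]|/eqP ->].
    apply/asboolP; exists z, x; split=> //.
    exact: belowL_trans zy' (belowL_trans y'y yx).
  by apply/asboolP/belowE; exact: belowL_refl.
pose leh X Y := (h X <= h Y)%N.
have leh_total : total leh by move=> X Y; exact: leq_total.
have leh_trans : transitive leh by move=> Y X Z; exact: leq_trans.
pose r := sort leh s.
have rC x : Lclass x \in r by rewrite mem_sort.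
have r_uniq : uniq r by rewrite sort_uniq undup_uniq.
have r_sorted : sorted leh r by exact: sort_sorted.
exists (size r), (fun x => index (Lclass x) r); split=> [a x|x y|x|k kr].
- have [xax|nxax] := pselect (belowL x (a * x)).
    by rewrite (@eq_Lclass x (a * x)) //; apply/greenLP; split=> //; exact: belowL_mul.
  rewrite leqNgt; apply/negP => lt_xax.
  have := h_lt _ _ (belowL_mul a x) nxax; rewrite ltnNge => /negP; apply.
  have := @sorted_leq_nth _ leh leh_trans (fun X => leqnn (h X)) set0 r r_sorted
    (index (Lclass x) r) (index (Lclass (a * x)) r).
  by rewrite !inE !index_mem !rC !nth_index//; apply => //; exact: ltnW.
- split=> [E|/eq_Lclass ->//].
  have := nth_index set0 (rC x); rewrite E nth_index// => yx.
  by have : Lclass y y := greenL_refl y; rewrite yx.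
- by rewrite index_mem.
- have : nth set0 r k \in s by rewrite -(mem_sort leh) mem_nth.
  rewrite sP => /asboolP[x _ xE]; exists x.
  by rewrite /Lclass xE index_uniq.
Qed.

End LinearExtension.

Lemma Lbar_act_Some X s (x : X) : X (s * val x) ->
  exists2 y : X, Lbar_act s (Some x) = Some y & val y = s * val x.
Proof.
move=> Xsx; rewrite /=; case: insubP => [y _ yE|]; first by exists y.
by rewrite mem_set.
Qed.

Lemma Lbar_act_None X s (x : X) : ~ X (s * val x) -> Lbar_act s (Some x) = None.
Proof. by move=> nX; rewrite /= insubF //; apply/negP => /set_mem. Qed.

End Green.

(** * Green's lemma for the acts of L-classes *)

(** Congruences pull back along a surjective morphism of acts, injectively. *)
Lemma Ht_Cong_le_of_surjection (S : semigroupType) (A B : left_act S) (g : B -> A) :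
    (forall a, exists b, g b = a) -> (forall s b, g (act s b) = act s (g b)) ->
  Ht (Cong A) #<= Ht (Cong B).
Proof.
move=> gsurj gact.
pose pull (c : set (A * A)) : set (B * B) := [set p | c (g p.1, g p.2)].
apply: (Ht_le_mono (f := pull)).
- move=> c [[crefl csym ctrans] cact]; split; last first.
    by move=> a b cab t; rewrite /pull /= !gact; exact: cact.
  split=> [a|a b|a b e]; [exact: crefl | exact: csym | exact: ctrans].
- move=> c c' _ _ E; apply/seteqP; split=> -[a a'];
  have [[b <-] [b' <-]] := (gsurj a, gsurj a').
    by move=> cbb; have : pull c (b, b') by []; rewrite E.
  by move=> cbb; have : pull c' (b, b') by []; rewrite -E.
- by move=> c c' /subsetPset cc'; apply/subsetPset => p; exact: cc'.
Qed.

Section GreenLemma.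
Variable S : semigroupType.
Implicit Types (s t x y : S) (X Y : set S).
Local Open Scope group_scope.

(** The right translation by [t] is an act isomorphism from [Lbar Y] to
[Lbar X].  That it respects the zero is where the inverse translation is used:
if [u * y * t] lies in [X], then [u * y = u * y * t * s] lies in [Y]. *)
Lemma Ht_Lbar_le_of_translation X Y (LX : Lclasses S X) (LY : Lclasses S Y) s t :
    (forall x, X x -> Y (x * s)) -> (forall y, Y y -> X (y * t)) ->
    (forall x, X x -> x * s * t = x) -> (forall y, Y y -> y * t * s = y) ->
  Ht (Cong (Lbar LX)) #<= Ht (Cong (Lbar LY)).
Proof.
move=> XsY YtX stK tsK.
pose g : Lbar LY -> Lbar LX := obind (fun y : Y => insub (val y * t)).
have gS (y : Y) : exists2 x : X, g (Some y) = Some x & val x = val y * t.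
  have Xyt := YtX _ (set_valP y); rewrite /g /=.
  by case: insubP => [x _ xE|]; [exists x | rewrite mem_set].
apply: (@Ht_Cong_le_of_surjection _ _ _ g) => [[x|]|u [y|//]]; last 2 first.
- by exists None.
- have [x gyx xE] := gS y; rewrite gyx -[LHS]/(g (Lbar_act u (Some y))).
  rewrite -[RHS]/(Lbar_act u (Some x)).
  have [Yuy|nYuy] := pselect (Y (u * val y)).
    have [z zE1 zE] := Lbar_act_Some Yuy; have [w gzw wE] := gS z.
    have Xux : X (u * val x) by rewrite xE mulgA -zE; exact: YtX (set_valP z).
    have [v vE1 vE] := Lbar_act_Some Xux.
    rewrite zE1 vE1 gzw; congr Some; apply: val_inj.
    by rewrite wE vE zE xE mulgA.
  rewrite (Lbar_act_None nYuy) Lbar_act_None //.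
  rewrite xE => Xuyt; apply: nYuy; have := XsY _ Xuyt.
  by rewrite mulgA -!mulgA [val y * _]mulgA tsK //; exact: set_valP.
have Yxs := XsY _ (set_valP x).
exists (Some (SigSub (mem_set Yxs))); have [z -> zE] := gS (SigSub (mem_set Yxs)).
by congr Some; apply: val_inj; rewrite zE /= stK //; exact: set_valP.
Qed.

Lemma Ht_Lbar_le_of_greenR x y (LX : Lclasses S (Lclass x)) (LY : Lclasses S (Lclass y)) :
  greenR x y -> Ht (Cong (Lbar LX)) #<= Ht (Cong (Lbar LY)).
Proof.
have mulK u v s t : v * s * t = v -> greenL v u -> u * s * t = u.
  by move=> vst /greenLP[_ [->//|[a ->]]]; rewrite -!mulgA [v * _]mulgA vst.
have same : x = y -> Ht (Cong (Lbar LX)) #<= Ht (Cong (Lbar LY)).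
  by move=> xy; subst y; rewrite (Prop_irrelevance LX LY).
move=> /greenR_below[[/same//|[t xE]] [/esym/same//|[s yE]]].
apply: (@Ht_Lbar_le_of_translation _ _ LX LY s t) => u xu.
- by rewrite yE; exact: greenL_mulr.
- by rewrite xE; exact: greenL_mulr.
- by apply: mulK xu; rewrite -yE -xE.
- by apply: mulK xu; rewrite -xE -yE.
Qed.

(** Having acts of the same height is an equivalence relation containing
[greenL] and [greenR], hence [greenD]; this avoids factoring [greenD] as the
composite of the two. *)
Lemma Ht_Lbar_eq_of_greenD x y (LX : Lclasses S (Lclass x)) (LY : Lclasses S (Lclass y)) :
  greenD x y -> Ht (Cong (Lbar LX)) #= Ht (Cong (Lbar LY)).
Proof.
pose E (u v : S) : Prop :=
  Ht (Cong (Lbar (Lclass_in u))) #= Ht (Cong (Lbar (Lclass_in v))).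
move=> /(_ E) xy; rewrite (Prop_irrelevance LX (Lclass_in x)).
rewrite (Prop_irrelevance LY (Lclass_in y)); apply: xy => [|a b ab|a b ab].
- split=> [a|a b|a b c]; rewrite /E; [exact: card_eqxx | by rewrite card_eq_sym |].
  exact: card_eq_trans.
- rewrite /E; move: (Lclass_in b); rewrite -(eq_Lclass ab) => Lb.
  by rewrite (Prop_irrelevance Lb (Lclass_in a)); exact: card_eqxx.
- by rewrite /E card_eq_le !Ht_Lbar_le_of_greenR.
Qed.

End GreenLemma.
(** * Layers of left congruences *)

Section Filtration.
Variable S : semigroupType.
Local Open Scope group_scope.

(** The function [key] encodes a filtration of [S] by the left ideals
[key x < k], with one L-class [key x = k] for each layer. *)
Variables (N : nat) (key : S -> nat).
Hypothesis key_mul : forall a x, (key (a * x)%g <= key x)%N.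
Hypothesis key_greenL : forall x y, key x = key y <-> greenL x y.
Hypothesis key_lt : forall x, (key x < N)%N.
Hypothesis key_surj : forall k, (k < N)%N -> exists x, key x = k.

Implicit Types (a u v x y z : S) (sigma tau : set (S * S)) (k : nat).

(** When [sigma] is contained in [tau], this says that both have the same trace
on the left ideal [key x < k]. *)
Definition agree k sigma tau :=
  forall x y, (key x < k)%N -> (key y < k)%N -> tau (x, y) -> sigma (x, y).

Definition low k sigma x := exists2 u, (key u < k)%N & sigma (x, u).

Section Layer.
Variables (X : set S) (LX : Lclasses S X) (k : nat).
Hypothesis levX : forall y, X y <-> key y = k.
Implicit Types (c : set (option X * option X)).

Lemma layer_neq0 : X !=set0.
Proof. by case: LX => x _ <-; exists x. Qed.

Lemma insub_layer x : X x -> exists2 x' : X, insub x = Some x' & val x' = x.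
Proof. by move=> Xx; case: insubP => [x' _ <-|]; [exists x' | rewrite mem_set]. Qed.

Lemma insub_off_layer x : ~ X x -> insub x = None :> option X.
Proof. by move=> nX; rewrite insubF //; apply/negP => /set_mem. Qed.

Lemma insub_below x : (key x < k)%N -> insub x = None :> option X.
Proof. by move=> xk; apply: insub_off_layer => /levX xE; rewrite xE ltnn in xk. Qed.

Lemma key_val (x : X) : key (val x) = k.
Proof. exact/levX/set_valP. Qed.

(** The point [None] stands for the left ideal below the layer. *)
Definition olow sigma (p : option X) :=
  if p is Some x then low k sigma (val x) else True.

(** The trace on the [k]-th layer of the join of [sigma] with the Rees congruence
of the left ideal below it. *)
Definition layer_quot sigma : set (option X * option X) :=
  [set p | (olow sigma p.1 /\ olow sigma p.2) \/
    exists x y : X, p = (Some x, Some y) /\ sigma (val x, val y)].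

Lemma layer_quot_cong sigma : LCong S sigma -> Cong (Lbar LX) (layer_quot sigma).
Proof.
move=> [[srefl ssym strans] sact].
have olow_rel (x y : X) :
    sigma (val x, val y) -> olow sigma (Some y) -> olow sigma (Some x).
  by move=> xy [u uk yu]; exists u => //; exact: strans xy yu.
have olow_act t p : olow sigma p -> olow sigma (Lbar_act t p).
  case: p => [x|//] [u uk xu]; have [Xtx|nXtx] := pselect (X (t * val x)).
    have [y -> /= ->] := Lbar_act_Some Xtx; exists (t * u); last exact: sact.
    exact: leq_ltn_trans (key_mul _ _) uk.
  by rewrite Lbar_act_None.
split; first split.
- by move=> [x|]; [right; exists x, x | left].
- move=> p q [[/= lp lq]|[x [y [[-> ->] xy]]]]; first by left.
  by right; exists y, x; split=> //; exact: ssym.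
- move=> p q r [[/= lp lq]|[x [y [/= [-> ->] xy]]]].
    move=> [[/= _ lr]|[y [z [/= [qE ->] yz]]]]; first by left.
    by left; split=> //; apply: (olow_rel _ y); [exact: ssym | rewrite -qE].
  move=> [[/= lq lr]|[y' [z [/= [<- ->] yz]]]].
    by left; split=> //; exact: olow_rel xy lq.
  by right; exists x, z; split=> //; exact: strans xy yz.
- move=> p q pq t; rewrite -[act t p]/(Lbar_act t p) -[act t q]/(Lbar_act t q).
  case: pq => [[/= lp lq]|[x [y [[-> ->] xy]]]]; first by left; split; exact: olow_act.
  have txy := sact _ _ xy t.
  have lower u v : sigma (u, v) -> ~ X v -> (key v <= k)%N -> low k sigma u.
    move=> uv nXv vk; exists v => //.
    by rewrite ltn_neqAle vk andbT; apply/eqP => /levX.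
  have le_k (x' : X) : (key (t * val x') <= k)%N by rewrite -(key_val x') key_mul.
  have [Xtx|nXtx] := pselect (X (t * val x)); have [Xty|nXty] := pselect (X (t * val y)).
  + have [x' -> xE] := Lbar_act_Some Xtx; have [y' -> yE] := Lbar_act_Some Xty.
    by right; exists x', y'; rewrite xE yE.
  + left; rewrite (Lbar_act_None nXty); split=> //.
    have [x' -> /= ->] := Lbar_act_Some Xtx.
    exact: lower txy nXty (le_k _).
  + left; rewrite (Lbar_act_None nXtx); split=> //.
    have [y' -> /= ->] := Lbar_act_Some Xty.
    exact: lower (ssym _ _ txy) nXtx (le_k _).
  + by left; rewrite !Lbar_act_None.
Qed.

Lemma layer_quot_mono sigma tau : sigma `<=` tau -> layer_quot sigma `<=` layer_quot tau.
Proof.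
move=> st; have lst p : olow sigma p -> olow tau p.
  by case: p => [x [u uk xu]|//]; exists u => //; exact: st.
move=> p [[lp lq]|[x [y [-> xy]]]]; first by left; split; exact: lst.
by right; exists x, y; split=> //; exact: st.
Qed.

(** Below the lowest layer there is nothing to be related to the zero.  This is
the reason why the lowest layer contributes its height minus one. *)
Lemma layer_quot0_neqT sigma : k = 0 -> layer_quot sigma <> setT.
Proof.
move=> k0 qT; have [x Xx] := layer_neq0.
have : layer_quot sigma (Some (SigSub (mem_set Xx)), None) by rewrite qT.
by move=> [[/= [u]]|[? [? []]]//]; rewrite k0 ltn0.
Qed.

(** The basic step: a congruence is determined on one more layer, among larger
ones with the same trace below, by its image in the layer.  If the image relates
[x] and [y] through the zero, then [sigma] relates [x] to some [u] and [y] to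
some [v] below, and [(u, v)], being in [tau], is already in [sigma]. *)
Lemma agree_step sigma tau : LCong S sigma -> LCong S tau -> sigma `<=` tau ->
  agree k sigma tau -> layer_quot tau `<=` layer_quot sigma -> agree k.+1 sigma tau.
Proof.
move=> [[_ ssym strans] _] [[_ tsym ttrans] _] st st_k qts.
have mixed (x : X) y : (key y < k)%N -> tau (val x, y) -> sigma (val x, y).
  move=> yk xy; have : layer_quot tau (Some x, None) by left; split=> //; exists y.
  move=> /qts[[/= [u uk xu] _]|[? [? []]]//]; apply: (strans _ u) => //.
  by apply: st_k => //; apply: ttrans xy; apply: tsym; exact: st.
move=> x y; rewrite !ltnS leq_eqVlt => /predU1P[xk|xk];
  rewrite leq_eqVlt => /predU1P[yk|yk] xy.
- have [x' _ x'E] := insub_layer ((levX x).2 xk).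
  have [y' _ y'E] := insub_layer ((levX y).2 yk).
  have : layer_quot tau (Some x', Some y') by right; exists x', y'; rewrite x'E y'E.
  move=> /qts[[/=]|[? [? [[<- <-]]]]]; last by rewrite x'E y'E.
  rewrite x'E y'E => -[u uk xu] [v vk yv].
  apply: (strans _ u) => //; apply: (strans _ v); last exact: ssym.
  apply: st_k => //; apply: (ttrans _ x); first by apply: tsym; exact: st.
  by apply: (ttrans _ y) => //; exact: st.
- by have [x' _ x'E] := insub_layer ((levX x).2 xk); rewrite -x'E in xy *; exact: mixed.
- have [y' _ y'E] := insub_layer ((levX y).2 yk); rewrite -y'E in xy *.
  by apply: ssym; apply: mixed => //; exact: tsym.
- exact: st_k.
Qed.

(** Equality above the layer, everything below it identified, and [c] on it. *)
Definition layer_ext (c : set (option X * option X)) : set (S * S) :=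
  [set p | p.1 = p.2 \/
    [/\ (key p.1 <= k)%N, (key p.2 <= k)%N & c (insub p.1, insub p.2)]].

Lemma layer_ext_cong c : Cong (Lbar LX) c -> LCong S (layer_ext c).
Proof.
move=> [[crefl csym ctrans] cact].
have act_insub t x : (key x <= k)%N -> Lbar_act t (insub x : option X) = insub (t * x).
  move=> xk; have [Xx|nXx] := pselect (X x); first by have [x' -> <-] := insub_layer Xx.
  rewrite insub_off_layer //= insub_below // (leq_ltn_trans (key_mul _ _)) //.
  by rewrite ltn_neqAle xk andbT; apply/eqP => /levX.
split; first split.
- by move=> x; left.
- move=> x y [/= ->|[/= xk yk xy]]; first by left.
  by right; split=> //; exact: csym.
- move=> x y z [/= ->//|[/= xk yk xy]] [/= <-|[/= _ zk yz]]; first by right.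
  by right; split=> //=; exact: ctrans xy yz.
- move=> x y [/= ->|[/= xk yk xy]] t; first by left.
  right; split=> /=; try exact: leq_trans (key_mul _ _) _.
  by rewrite -!act_insub //; exact: cact.
Qed.

Lemma layer_ext_mono c c' : c `<=` c' -> layer_ext c `<=` layer_ext c'.
Proof. by move=> cc' p [E|[xk yk /cc' ?]]; [left | right]. Qed.

(** A class in the lowest layer is a minimal left ideal, so a relation
between one of its elements and the zero spreads to all of them. *)
Lemma cong_layer0_top c : k = 0 -> Cong (Lbar LX) c -> forall x : X,
  c (Some x, None) -> c = setT.
Proof.
move=> k0 [[crefl csym ctrans] cact] x x0.
have c0 p : c (p, None).
  case: p => [y|]; last exact: crefl.
  have : belowL (val y) (val x).
    by have /greenLP[] : greenL (val y) (val x) by apply/key_greenL; rewrite !key_val.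
  move=> [/val_inj ->//|[a yE]].
  have Xax : X (a * val x) by rewrite -yE; exact: set_valP.
  have [z axz zE] := Lbar_act_Some Xax.
  have -> : y = z by apply: val_inj; rewrite zE yE.
  by rewrite -axz; exact: (cact _ _ x0 a).
apply/seteqP; split=> -[p q] // _; apply: ctrans (c0 p) _; exact: csym.
Qed.

(** The pairs in [c] are recovered from the extension; those with the zero need
an element of a lower layer, or else are excluded because [c] is not total. *)
Lemma layer_ext_inj c c' : Cong (Lbar LX) c -> Cong (Lbar LX) c' ->
  (k = 0 -> c <> setT) -> layer_ext c `<=` layer_ext c' -> c `<=` c'.
Proof.
move=> congc [[crefl csym ctrans] _] cT cc'.
have [[_ ccsym _] _] := congc.
have insub_val (x : X) : insub (val x) = Some x by exact: valK.
have mixed (x : X) : c (Some x, None) -> c' (Some x, None).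
  move=> x0; have [k0|k_gt0] := posnP k.
    by case: (cT k0); exact: cong_layer0_top congc _ x0.
  have [z zE] : exists z, key z = 0.
    by apply: key_surj; apply: leq_ltn_trans (key_lt (val x)).
  have zk : (key z < k)%N by rewrite zE.
  have : layer_ext c (val x, z).
    by right; split; rewrite /= ?key_val ?insub_val ?(insub_below zk) // ltnW.
  move=> /cc'[/= xz|[_ _ /=]]; last by rewrite insub_val insub_below.
  by move: zk; rewrite -xz key_val ltnn.
move=> [[x|] [y|]] xy;
  [|exact: mixed|by apply: csym; apply: mixed; exact: ccsym|exact: crefl].
have : layer_ext c (val x, val y) by right; split; rewrite /= ?key_val ?insub_val.
by move=> /cc'[/= /val_inj ->|[_ _ /=]]; [exact: crefl | rewrite !insub_val].
Qed.

End Layer.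
(** * Height of the lattice of left congruences *)

Lemma Lclass_level : exists lev : Lclasses S -> nat,
  forall (X : Lclasses S) y, val X y <-> key y = lev X.
Proof.
suff /boolp.choice[lev levP] : forall X : Lclasses S,
    exists k, forall y, val X y <-> key y = k.
  by exists lev.
move=> X; have [x _ xE] := set_valP X; exists (key x) => y.
by rewrite -xE; split=> [/key_greenL|/esym/key_greenL].
Qed.

Variable lev : Lclasses S -> nat.
Hypothesis levP : forall (X : Lclasses S) y, val X y <-> key y = lev X.

Notation actL X := (Lbar (set_valP X)).
Notation summand := (fun X : Lclasses S => card_subn (Ht (Cong (actL X))) 1).

Lemma lev_inj : injective lev.
Proof.
move=> X Y XY; apply: val_inj; apply/seteqP.
by split=> y /levP yE; apply/levP; rewrite yE XY.
Qed.

Lemma lev_surj k : (k < N)%N -> exists X, lev X = k.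
Proof.
move=> /key_surj[x <-]; exists (SigSub (mem_set (Lclass_in x))).
by apply/esym/levP; exact: greenL_refl.
Qed.

(** A member [sigma] of a chain [C] is placed at the lowest layer [k] such that
[sigma] is the greatest member of [C] with its trace on layers up to [k].  By
minimality of [k], if [k] is not the lowest layer, some larger member [rho] has
the same trace below layer [k].  If the image of [sigma] in layer [k] were total,
or were also that of a larger member placed at [k], then [rho] (or this other
member) would have the same image as [sigma], hence by [agree_step] the same
trace up to layer [k], against the choice of [k]. *)
Lemma Ht_LCong_le (x0 : S) : Ht (LCong S) #<= [set: {X : Lclasses S & summand X}].
Proof.
apply: Ht_le_of_chains => C [CL Ctot].
pose good sigma k := forall tau, C tau -> sigma `<=` tau ->
  agree k.+1 sigma tau -> tau `<=` sigma.
pose q (X : Lclasses S) := @layer_quot (val X) (lev X).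
have q_chain X : chains (Cong (actL X)) (q X @` C `|` [set setT]).
  split=> [_ [[sigma /CL Ls <-]|->]|_ _ [[sigma Cs <-]|->] [[tau Ct <-]|->]].
  - exact: (layer_quot_cong (set_valP X) (levP X) Ls).
  - by split.
  - have [/subsetPset st|/subsetPset ts] := Ctot _ _ Cs Ct; [left|right].
      by apply/subsetPset; exact: layer_quot_mono.
    by apply/subsetPset; exact: layer_quot_mono.
  - by left; apply/subsetPset.
  - by right; apply/subsetPset.
  - by left; apply/subsetPset.
pose at_level sigma X := good sigma (lev X) /\ forall j, (j < lev X)%N -> ~ good sigma j.
have step sigma tau X : C sigma -> C tau -> sigma `<=` tau ->
    agree (lev X) sigma tau -> q X tau `<=` q X sigma -> good sigma (lev X) ->
  tau `<=` sigma.
  move=> Cs Ct st ast qts; apply => //.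
  exact: (agree_step (levP X) (CL _ Cs) (CL _ Ct) st ast qts).
have bad sigma X : C sigma -> at_level sigma X -> lev X <> 0 ->
    exists rho, [/\ C rho, sigma `<=` rho, agree (lev X) sigma rho & ~ rho `<=` sigma].
  move=> Cs [_ minX] X0; have := minX (lev X).-1.
  case: (lev X) X0 => // j _ /(_ (leqnn _)).
  apply: contra_notP => norho rho Cr sr asr.
  by apply: contrapT => nrs; apply: norho; exists rho.
have q_dom sigma X : C sigma -> at_level sigma X ->
    ((q X @` C `|` [set setT]) `\ setT) (q X sigma).
  move=> Cs sX; split=> [|qT]; first by left; exists sigma.
  have [X0|X_gt0] := posnP (lev X).
    exact: (layer_quot0_neqT (set_valP X) X0 qT).
  have [|rho [Cr sr asr]] := bad _ _ Cs sX; first by move=> X0; rewrite X0 in X_gt0.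
  by apply; apply: step asr _ sX.1 => //; rewrite qT.
apply: (card_le_sigT (tag := at_level) (g := q)
  (fun X => chainD1_le_card_subn (q_chain X) (or_intror erefl)) _
  (fun sigma X Cs sX => q_dom sigma X Cs sX)).
  move=> sigma Cs.
  have good_top : good sigma N.-1.
    move=> tau Ct st aN [x y].
    rewrite prednK in aN; last exact: leq_ltn_trans (key_lt x0).
    by apply: aN; exact: key_lt.
  have exk : exists k, `[< good sigma k >] by exists N.-1; apply/asboolP.
  have [k /asboolP gk mink] := ex_minnP exk.
  have [|X XE] := @lev_surj k.
    rewrite (leq_ltn_trans (mink N.-1 _)) //; first exact/asboolP.
    by rewrite prednK //; exact: leq_ltn_trans (key_lt x0).
  exists X; split=> [|j]; rewrite XE // ltnNge => /negP jk gj; apply: jk.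
  by apply: mink; apply/asboolP.
move=> sigma tau X Cs Ct sX tX qst.
(* By symmetry, it is enough to compare two members [s] and [t], [s] being the
   smaller. *)
have half s t : C s -> C t -> at_level s X -> q X s = q X t -> s `<=` t -> t `<=` s.
  move=> Ds Dt sX' qE st; have [ast|nast] := pselect (agree (lev X) s t).
    by apply: step ast _ sX'.1 => //; rewrite qE.
  have [|rho [Cr sr asr nrs]] := bad _ _ Ds sX'.
    by move=> X0; apply: nast => x y; rewrite X0.
  have [/subsetPset rt|/subsetPset tr] := Ctot _ _ Cr Dt.
    case: nrs; apply: step asr _ sX'.1 => //; rewrite qE.
    exact: layer_quot_mono.
  by case: nast => x y xk yk /tr; exact: asr.
have [/subsetPset st|/subsetPset ts] := Ctot _ _ Cs Ct; apply/seteqP; split=> //.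
  exact: (half _ _ Cs Ct sX qst st).
exact: (half _ _ Ct Cs tX (esym qst) ts).
Qed.

(** The congruence left out of each summand when chains are put on top of each
other.  Above the lowest layer it is equality, whose extension is also that of
the largest congruence of the previous layer.  On the lowest layer it is the
total one, which has the same extension as the congruence whose classes are the
L-class and the zero. *)
Definition dropped (X : Lclasses S) : set (actL X * actL X) :=
  if lev X == 0 then setT else [set p | p.1 = p.2].

Arguments dropped : clear implicits.

Definition ext (X : Lclasses S) (c : set (actL X * actL X)) : set (S * S) :=
  @layer_ext (val X) (lev X) c.

Lemma ext_cong X c : Cong (actL X) c -> LCong S (ext c).
Proof. exact: (layer_ext_cong (levP X)). Qed.

(** The extension of [d] identifies everything below its layer, and so all pairs
that [ext c] can relate. *)
Lemma ext_below X Y (c : set (actL X * actL X)) (d : set (actL Y * actL Y)) :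
  (lev X < lev Y)%N -> Cong (actL Y) d -> ext c `<=` ext d.
Proof.
move=> XY [[drefl _ _] _] [x y] [/= ->|[/= xX yX _]]; first by left.
have [xY yY] := (leq_ltn_trans xX XY, leq_ltn_trans yX XY).
right; split; rewrite /= ?(ltnW xY) ?(ltnW yY) //.
by rewrite !(insub_below (@levP Y)) //; exact: drefl.
Qed.

(** A congruence [d] other than equality relates an element of its layer to
another one or to the zero, and then to an element of lower layers; [ext c] does
neither. *)
Lemma ext_below_proper X Y (c : set (actL X * actL X)) (d : set (actL Y * actL Y)) :
  (lev X < lev Y)%N -> Cong (actL Y) d -> d <> dropped Y -> ~ ext d `<=` ext c.
Proof.
move=> XY [[drefl dsym _] _] dD dc; apply: dD.
rewrite /dropped gtn_eqF ?(leq_ltn_trans _ XY) //.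
have new (y : val Y) z : (key z <= lev Y)%N -> d (Some y, insub z) -> val y = z.
  move=> zY yz; have : ext d (val y, z).
    by right; split; rewrite /= ?(key_val (@levP Y)) ?valK.
  by move=> /dc[//|[]]; rewrite /= (key_val (@levP Y)) leqNgt XY.
have noNone (y : val Y) : ~ d (Some y, None).
  have YN : (lev Y < N)%N by rewrite -(key_val (@levP Y) y).
  have [z zX] := key_surj (ltn_trans XY YN).
  move=> y0; have := new y z.
  rewrite (insub_below (@levP Y)) zX // => /(_ (ltnW XY) y0) yz.
  by have := key_val (@levP Y) y; rewrite yz zX => E; rewrite E ltnn in XY.
apply/seteqP; split=> [[[y|] [z|]]|[p q] /= ->]; last exact: drefl.
- move=> yz; congr Some; apply: val_inj; apply: new; first by rewrite (key_val (@levP Y)).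
  by rewrite valK.
- by move=> /noNone.
- by move=> /dsym/noNone.
- by [].
Qed.

Lemma ext_le_inj X (c d : set (actL X * actL X)) : Cong (actL X) c -> Cong (actL X) d ->
  c <> dropped X -> ext c `<=` ext d -> c `<=` d.
Proof.
move=> Xc Xd cD; apply: (layer_ext_inj (levP X) Xc Xd) => X0.
by move: cD; rewrite /dropped X0.
Qed.

(** Chains of congruences of the layers are concatenated to one chain of left
congruences. *)
Lemma sum_le_Ht_LCong (F : Lclasses S -> Type)
    (D : forall X, set (set (actL X * actL X))) :
    (forall X, chains (Cong (actL X)) (D X)) -> (forall X, ~ D X (dropped X)) ->
    (forall X, [set: F X] #<= D X) ->
  [set: {X : Lclasses S & F X}] #<= Ht (LCong S).
Proof.
move=> chD Ddrop FD.
pose E : set (set (S * S)) := [set sigma |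
  exists X (c : set (actL X * actL X)), D X c /\ sigma = ext c].
have extP X c : D X c -> Cong (actL X) c /\ c <> dropped X.
  by move=> Dc; split; [exact: (chD X).1 | move=> cD; apply: (Ddrop X); rewrite -cD].
have chE : chains (LCong S) E.
  split=> [_ [X [c [/extP[Xc _] ->]]]|_ _ [X [c [Dc ->]]] [Y [d [Dd ->]]]].
    exact: ext_cong.
  have [XY|YX|XY] := ltngtP (lev X) (lev Y).
  - by left; apply/subsetPset; apply: ext_below => //; exact: (extP _ _ Dd).1.
  - by right; apply/subsetPset; apply: ext_below => //; exact: (extP _ _ Dc).1.
  - move/lev_inj: XY => XY; subst Y.
    have [/subsetPset cd|/subsetPset dc] := (chD X).2 _ _ Dc Dd; [left|right].
      by apply/subsetPset; exact: layer_ext_mono.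
    by apply/subsetPset; exact: layer_ext_mono.
apply: card_le_trans (chain_le_Ht chE).
apply: (sigT_card_le (g := ext) FD) => [X c Dc|X Y c d Dc Dd cd|X c d Dc Dd cd].
- by exists X, c.
- have [[Xc cD] [Yd dD]] := (extP _ _ Dc, extP _ _ Dd).
  have [XY|YX|/lev_inj//] := ltngtP (lev X) (lev Y).
    by case: (ext_below_proper (c := c) XY Yd dD); rewrite cd.
  by case: (ext_below_proper (c := d) YX Xc cD); rewrite cd.
- have [[Xc cD] [Xd dD]] := (extP _ _ Dc, extP _ _ Dd).
  by apply/seteqP; split; apply: ext_le_inj => //; rewrite cd.
Qed.

Lemma summand_le_Ht_LCong X : [set: summand X] #<= Ht (LCong S).
Proof.
apply: (card_subn_Ht_le (p := dropped X)) => C [CX Ctot].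
have ch : chains (LCong S) (@ext X @` (C `\ dropped X)).
  split=> [_ [c [/CX Xc _] <-]|_ _ [c [Cc _] <-] [d [Cd _] <-]]; first exact: ext_cong.
  have [/subsetPset cd|/subsetPset dc] := Ctot _ _ Cc Cd; [left|right].
    by apply/subsetPset; exact: layer_ext_mono.
  by apply/subsetPset; exact: layer_ext_mono.
apply: card_le_trans (chain_le_Ht ch).
apply: (card_le_inj_in (f := @ext X)) => [c Cc|c d [/CX Xc cD] [/CX Xd dD] cd].
  by exists c.
by apply/seteqP; split; apply: ext_le_inj => //; rewrite cd.
Qed.

Lemma Ht_LCong_ge : [set: {X : Lclasses S & summand X}] #<= Ht (LCong S).
Proof.
have [fin|] := pselect (forall X : Lclasses S, finite_set (Ht (Cong (actL X)))).
  have attained (X : Lclasses S) := cid2 (finite_Ht_attained (fin X)).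
  pose C X := s2val (attained X).
  apply: (@sum_le_Ht_LCong _ (fun X => C X `\ dropped X)) => X.
  - split=> [c [/(s2valP (attained X)).1//]|c d [Cc _] [Cd _]].
    exact: (s2valP (attained X)).2.
  - by move=> [_]; apply.
  - have /finite_setP[n Hn] := fin X; have Cn := card_eq_trans (s2valP' (attained X)) Hn.
    rewrite (card_le_eql (card_subn_finite 1 Hn)) (card_le_eqr (card_setD1_II _ Cn)).
    by rewrite card_le_II leq_sub2l // leq_b1.
move=> /existsNP[X0 X0inf].
have LCong_inf : infinite_set (Ht (LCong S)).
  move=> fin; apply: (X0inf); apply: card_le_finite fin.
  rewrite -(card_le_eql (card_subn_infinite 1 X0inf)); exact: summand_le_Ht_LCong.
apply: card_le_trans (infinite_mulnat LCong_inf).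
apply: (@sigT_card_le (Lclasses S) _ (fun _ => set (S * S)) _ _
  (fun _ => Ht (LCong S)) (fun X c => (c, lev X)) summand_le_Ht_LCong).
- by move=> X c.
- by move=> X Y c d _ _ [_ /lev_inj].
- by move=> X c d _ _ [].
Qed.
End Filtration.

(** Additivity of the height along the filtration by L-classes. *)
Lemma Ht_LCong_Lclasses (S : semigroupType) : inhabited S ->
    finite_set (Lclasses S) ->
  Ht (LCong S) #=
    [set: {X : Lclasses S & card_subn (Ht (Cong (Lbar (set_valP X)))) 1}].
Proof.
move=> [x0] /Lclass_ranking[N [key [key_mul key_greenL key_lt key_surj]]].
have [lev levP] := Lclass_level key_greenL.
rewrite card_eq_le (Ht_LCong_le key_mul key_lt key_surj levP x0).
exact: (Ht_LCong_ge key_mul key_greenL key_lt key_surj levP).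
Qed.

(** * Collecting L-classes into D-classes *)

Definition Dclass (S : semigroupType) (x : S) : set S := [set y | greenD x y].

Lemma greenD_equivalence (S : semigroupType) : Equivalence (@greenD S).
Proof.
split=> [x|x y xy|x y z xy yz] E Eeq EL ER.
- exact: Equivalence_Reflexive.
- by apply: Equivalence_Symmetric; exact: xy.
- by apply: Equivalence_Transitive (xy E Eeq EL ER) (yz E Eeq EL ER).
Qed.

Lemma Lclass_sub_Dclass (S : semigroupType) (X D : set S) x :
  Lclasses S X -> Dclasses S D -> X x -> D x -> X `<=` D.
Proof.
move=> LX [z _ <-] Xx zx y; rewrite (LclassesP LX Xx) => xy E Eeq EL ER.
by apply: Equivalence_Transitive (zx E Eeq EL ER) (EL _ _ xy).
Qed.

Lemma DclassesP (S : semigroupType) (D D' : set S) x :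
  Dclasses S D -> Dclasses S D' -> D x -> D' x -> D = D'.
Proof.
have [_ sym trans] := greenD_equivalence S.
move=> [z _ <-] [z' _ <-] zx z'x; apply/seteqP; split=> y.
  by move=> zy; apply: trans z'x (trans _ _ _ (sym _ _ zx) zy).
by move=> z'y; apply: trans zx (trans _ _ _ (sym _ _ z'x) z'y).
Qed.

Theorem theorem6p3 (S : semigroupType) (S_nonempty : inhabited S)
    (finL : finite_set (Lclasses S))
    (n : nat) (L : 'I_n -> set S) (L_class : forall r, Lclasses S (L r))
    (L_repr : forall D, Dclasses S D -> exists! r : 'I_n, L r `<=` D)
    (m : 'I_n -> nat)
    (m_card : forall (r : 'I_n) (D : set S), Dclasses S D -> L r `<=` D ->
       Lclasses_in D #= `I_(m r)) :
  Ht (LCong S) #=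
    [set: {r : 'I_n & 'I_(m r) * card_subn (Ht (Cong (Lbar (L_class r)))) 1}%type].
Proof.
have [Drefl Dsym Dtrans] := greenD_equivalence S.
(* [D r] is the D-class of [L r], and [rho] sends an L-class to the index of
   its D-class. *)
have /boolp.choice[D DP] r : exists D, Dclasses S D /\ L r `<=` D.
  have [x _ xE] := L_class r; have Lx : L r x by rewrite -xE.
  exists (Dclass x); split; first by exists x.
  by apply: Lclass_sub_Dclass Lx (Drefl x) => //; exists x.
have /boolp.choice[rho rhoP] (X : Lclasses S) : exists r, val X `<=` D r.
  have [x _ xE] := set_valP X; have Xx : val X x by rewrite -xE.
  have Dx : Dclasses S (Dclass x) by exists x.
  have [r [Lr _]] := L_repr _ Dx; exists r.
  suff -> : D r = Dclass x.
    by apply: Lclass_sub_Dclass Xx (Drefl x) => //; exact: set_valP.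
  have [y _ yE] := L_class r; have Ly : L r y by rewrite -yE.
  by apply: DclassesP (DP r).1 Dx ((DP r).2 _ Ly) (Lr _ Ly).
have rho_eq (X : Lclasses S) r : val X `<=` D r -> rho X = r.
  move=> XD; have [x _ xE] := set_valP X; have Xx : val X x by rewrite -xE.
  have [r0 [_ r0u]] := L_repr _ (DP r).1.
  rewrite -(r0u r (DP r).2) -(r0u (rho X)) //.
  rewrite (DclassesP (DP r).1 (DP (rho X)).1 (XD _ Xx) (rhoP X _ Xx)).
  exact: (DP (rho X)).2.
apply: card_eq_trans (Ht_LCong_Lclasses S_nonempty finL) _.
apply: (card_eq_sigT_fibres (rho := rho) (M := fun r => 'I_(m r))
  (G := fun r => card_subn (Ht (Cong (Lbar (L_class r)))) 1)) => [r|X r <- {r}].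
  rewrite card_eq_sym -(card_eql card_II) card_eq_sym.
  rewrite -(card_eqr (m_card _ _ (DP r).1 (DP r).2)).
  suff -> : Lclasses_in (D r) = val @` [set X | rho X = r].
    by rewrite card_eq_sym; apply: inj_card_eq => X Y _ _ /val_inj.
  apply/seteqP; split=> [X [LX XD]|_ [X <- <-]].
    by exists (SigSub (mem_set LX)) => //=; exact: rho_eq.
  by split; [exact: set_valP | exact: rhoP].
apply: card_subn_eq; set r := rho X.
have [x _ xE] := set_valP X; have [y _ yE] := L_class r.
have xy : greenD x y.
  have Xx : val X x by rewrite -xE.
  have Ly : L r y by rewrite -yE.
  have [[z _ zE] Dsub] := DP r.
  have [zx zy] : greenD z x /\ greenD z y.
    by move: (rhoP X _ Xx) (Dsub _ Ly); rewrite -/r -zE.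
  exact: Dtrans (Dsym _ _ zx) zy.
move: (set_valP X) (L_class r); rewrite -xE -yE => LX LY.
exact: Ht_Lbar_eq_of_greenD.
Qed.
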